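(* Let $g\ge 1$ and let $(u,B)\in (\mathbb{C}^g \times \mathbb{H}_g) \setminus \Theta_g$. Then for every $m,n \in \mathbb{Z}^g$ we have $$X_{(u+im+B n,\,B)} \sim X_{(u,B)} +n.$$
   Context: Notation: $\mathbf{e}(x)=e^{2\pi x}$. $\mathbb{H}_g=\{B\in\mathbb{C}^{g\times g} : B^t=B,\ \operatorname{Re}B\succ 0\}$. The Riemann theta function is $\theta\colon\mathbb{C}^g\times\mathbb{H}_g\to\mathbb{C}$, $\theta(u,B)=\sum_{n\in\mathbb{Z}^g}\mathbf{e}(-\frac12 n^tBn+n^tu)$, and $\Theta_g=\{(u,B)\in\mathbb{C}^g\times\mathbb{H}_g:\theta(u,B)=0\}$. For $(u,B)\notin\Theta_g$, the (complex) discrete Gaussian distribution with parameters $(u,B)$ is the complex-valued probability distribution on $\mathbb{Z}^g$ given by $p_\theta(n;u,B)=\frac{1}{\theta(u,B)}\mathbf{e}(-\frac12 n^tBn+n^tu)$ (the values sum to $1$); $X_{(u,B)}$ denotes a random variable with values in $\mathbb{Z}^g$ and this distribution, i.e. $\mathbb{P}(X_{(u,B)}=n)=p_\theta(n;u,B)$. $X\sim Y$ means that $X$ and $Y$ have the same distribution. The set $\Theta_g$ is invariant under $(u,B)\mapsto(u+im+Bn,B)$ for $m,n\in\mathbb{Z}^g$, so the left-hand side of the claim is defined. *)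

(* Defs.v *)
From HB Require Import structures.
From mathcomp Require Import all_boot all_order all_algebra.
From mathcomp Require Import complex.
From mathcomp Require Import all_classical all_reals all_analysis.
From mathcomp Require summability.

Set Implicit Arguments.
Unset Strict Implicit.
Unset Printing Implicit Defensive.

Import Order.TTheory GRing.Theory Num.Theory.
Import numFieldNormedType.Exports.

Local Open Scope classical_set_scope.
Local Open Scope complex_scope.
Local Open Scope ring_scope.

Definition cexp (R : realType) (z : R[i]) : R[i] :=
  (expR (complex.Re z))%:C * (cos (complex.Im z) +i* sin (complex.Im z)).

(* The factor is 2 pi, not 2 pi i. *)
Definition e2pi (R : realType) (z : R[i]) : R[i] := cexp (2 * pi%:C * z).

Definition zvec (R : realType) (g : nat) (n : 'cV[int]_g) : 'cV[R[i]]_g :=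
  map_mx intr n.

Definition siegel (R : realType) (g : nat) : set 'M[R[i]]_g :=
  [set B | B^T = B /\
     forall x : 'cV[R]_g, x != 0 ->
       0 < (x^T *m map_mx (@complex.Re R) B *m x) 0 0].

Definition theta_term (R : realType) (g : nat)
    (u : 'cV[R[i]]_g) (B : 'M[R[i]]_g) (n : 'cV[int]_g) : R[i] :=
  e2pi (- (2^-1 * ((zvec R n)^T *m B *m zvec R n) 0 0)
        + ((zvec R n)^T *m u) 0 0).

(* [R[i]^o] carries the topology of the complex norm (there is no instance on
   [R[i]] itself); [summability.sum] is the unconditional sum: the limit of the partial sums
   along the directed set of the finite subsets of the index type. *)
Definition theta (R : realType) (g : nat)
    (u : 'cV[R[i]]_g) (B : 'M[R[i]]_g) : R[i] :=
  @summability.sum _ R[i] R[i]^o (theta_term u B).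

Definition Theta (R : realType) (g : nat) : set ('cV[R[i]]_g * 'M[R[i]]_g) :=
  [set uB | siegel uB.2 /\ theta uB.1 uB.2 = 0].

(* Meaningful for (u, B) outside [Theta]; the division is total. *)
Definition p_theta (R : realType) (g : nat)
    (n : 'cV[int]_g) (u : 'cV[R[i]]_g) (B : 'M[R[i]]_g) : R[i] :=
  (theta u B)^-1 * theta_term u B n.

(* The library's measures and charges have values in the extended reals. *)
Record cprobability (R : realType) (d : measure_display)
    (T : measurableType d) := CProbability {
  cprob :> set T -> R[i];
  cprob_sigma_additive : forall F : (set T)^nat,
    (forall k, measurable (F k)) -> trivIset setT F ->
    (fun N => \sum_(0 <= k < N) cprob (F k) : R[i]^o) @ \oo -->
      (cprob (\bigcup_k F k) : R[i]^o);
  cprob_setT : cprob setT = 1 }.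

(* Measurable for the discrete sigma-algebra on Z^g. *)
Record lattice_rv (g : nat) (d : measure_display)
    (T : measurableType d) := LatticeRV {
  rv_fun :> T -> 'cV[int]_g;
  rv_measurable : forall A : set 'cV[int]_g, measurable (rv_fun @^-1` A) }.

Lemma shift_measurable (g : nat) (d : measure_display) (T : measurableType d)
    (X : lattice_rv g T) (n : 'cV[int]_g) (A : set 'cV[int]_g) :
  measurable ((fun t => X t + n) @^-1` A).
Proof. exact: (rv_measurable X [set k | A (k + n)]). Qed.

Definition shift_rv (g : nat) (d : measure_display) (T : measurableType d)
    (X : lattice_rv g T) (n : 'cV[int]_g) : lattice_rv g T :=
  LatticeRV (shift_measurable X n).

Definition law (R : realType) (g : nat) (d : measure_display)
    (T : measurableType d) (P : cprobability R T) (X : lattice_rv g T)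
    (A : set 'cV[int]_g) : R[i] :=
  P (X @^-1` A).

(* The two random variables may live on different spaces. *)
Definition same_law (R : realType) (g : nat)
    (d1 d2 : measure_display) (T1 : measurableType d1) (T2 : measurableType d2)
    (P1 : cprobability R T1) (X1 : lattice_rv g T1)
    (P2 : cprobability R T2) (X2 : lattice_rv g T2) : Prop :=
  forall A : set 'cV[int]_g, law P1 X1 A = law P2 X2 A.

Definition is_discrete_gaussian (R : realType) (g : nat) (d : measure_display)
    (T : measurableType d) (P : cprobability R T) (X : lattice_rv g T)
    (u : 'cV[R[i]]_g) (B : 'M[R[i]]_g) : Prop :=
  forall k : 'cV[int]_g, law P X [set k] = p_theta k u B.

(* Main.v *)
Require Import Defs.
From mathcomp Require Import all_boot all_order all_algebra.
From mathcomp Require Import ring.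
From mathcomp Require Import complex.
From mathcomp Require Import all_classical all_reals all_analysis.

Import Order.TTheory GRing.Theory Num.Theory.
Local Open Scope classical_set_scope.
Local Open Scope ring_scope.

(** Completing the square and using that e(ik.m) = 1 for integer k, m, the
    k-th theta term at (u + im + Bn, B) is a constant multiple of the
    (k - n)-th term at (u, B). Hence the two laws are proportional on points,
    so by countable additivity they are proportional, and since both have
    total mass 1 the factor is 1: the quasi-periodicity of the sum theta
    itself, hence its convergence, is bypassed. *)

Lemma cexpD (R : realType) (z w : R[i]) : cexp (z + w) = cexp z * cexp w.
Proof.
case: z w => [a b] [c d]; rewrite /cexp /= expRD cosD sinD.
by apply/eqP; rewrite eq_complex /=; apply/andP; split; apply/eqP; ring.
Qed.

Lemma e2piD (R : realType) (z w : R[i]) : e2pi (z + w) = e2pi z * e2pi w.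
Proof. by rewrite /e2pi mulrDr cexpD. Qed.

Lemma e2pi_imaginary_int (R : realType) (k : int) :
  e2pi ('i%C * k%:~R) = 1 :> R[i].
Proof.
have e2pi_nat (j : nat) : e2pi ('i%C * j%:R) = 1 :> R[i].
  elim: j => [|j IHj].
    by rewrite mulr0 /e2pi mulr0 /cexp /= expR0 cos0 sin0 mul1r.
  rewrite -natr1 mulrDr e2piD IHj mul1r mulr1 /e2pi /cexp.
  have -> : 2 * (pi%:C)%C * 'i%C = (0 +i* (pi *+ 2))%C :> R[i].
    by apply/eqP; rewrite eq_complex /=; apply/andP; split; apply/eqP; ring.
  by rewrite /= expR0 cos2pi sin2pi mul1r.
case: k => j; first exact: e2pi_nat.
(* For k = -(j+1), the value is the inverse of the one at j+1, because the two exponents add up to 0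
   and e(0) = 1. *)
have e2pi0 : e2pi 0 = 1 :> R[i] by rewrite -[0](mulr0 'i%C); exact: (e2pi_nat 0).
rewrite -[RHS]e2pi0 -(addNr ('i%C * j.+1%:R)) e2piD e2pi_nat mulr1.
by rewrite NegzE mulrNz mulrN.
Qed.

Lemma zvecB (R : realType) (g : nat) (k n : 'cV[int]_g) :
  zvec R (k - n) = zvec R k - zvec R n.
Proof. by rewrite /zvec map_mxB. Qed.

Lemma zvec_dot (R : realType) (g : nat) (k m : 'cV[int]_g) :
  ((zvec R k)^T *m zvec R m) 0 0 = ((k^T *m m) 0 0)%:~R.
Proof. by rewrite /zvec map_trmx -map_mxM mxE. Qed.

Lemma theta_term_quasiperiodic (R : realType) (g : nat)
    (u : 'cV[R[i]]_g) (B : 'M[R[i]]_g) (m n k : 'cV[int]_g) :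
  B^T = B ->
  theta_term (u + 'i%C *: zvec R m + B *m zvec R n) B k =
  e2pi (2^-1 * ((zvec R n)^T *m B *m zvec R n) 0 0 + ((zvec R n)^T *m u) 0 0)
  * theta_term u B (k - n).
Proof.
move=> symB; rewrite /theta_term zvecB -e2piD.
(* A factor 1 = e(i k.m) is inserted on the right, so that each side is a single [e2pi] and only an
   identity between exponents remains. *)
rewrite -[RHS]mulr1 -[X in _ = _ * X](e2pi_imaginary_int R ((k^T *m m) 0 0)).
rewrite -e2piD -zvec_dot.
set x := zvec R k; set y := zvec R n; set z := zvec R m.
(* A scalar equals its own transpose; with B symmetric, the two cross terms of the expanded square
   coincide. *)
have yBx : (y^T *m B *m x) 0 0 = (x^T *m B *m y) 0 0.
  by rewrite -[in LHS](trmxK (y^T *m B *m x)) mxE !trmx_mul trmxK symB mulmxA.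
congr e2pi.
have entryD (a b : 'M[R[i]]_1) : (a + b) 0 0 = a 0 0 + b 0 0 by rewrite mxE.
have entryN (a : 'M[R[i]]_1) : (- a) 0 0 = - a 0 0 by rewrite mxE.
have entryZ c (a : 'M[R[i]]_1) : (c *: a) 0 0 = c * a 0 0 by rewrite mxE.
rewrite [(x - y)^T]linearB /= !(mulmxDl, mulmxDr, mulmxN, mulNmx, mulmxA, opprK).
rewrite -scalemxAr !(entryD, entryN, entryZ) yBx.
by field.
Qed.

Lemma complex_cvg_unique {R : realType} {f : nat -> R[i]^o} {a b : R[i]} :
  f @ \oo --> (a : R[i]^o) -> f @ \oo --> (b : R[i]^o) -> a = b.
Proof. exact: (@cvg_unique R[i]^o (@norm_hausdorff _ R[i]^o)). Qed.

(** Countable additivity on the constantly empty sequence makes the sums of N copies of [P set0]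
    converge. Their consecutive differences, all equal to [P set0], then tend to 0. *)
Lemma cprob_set0 (R : realType) (d : measure_display) (T : measurableType d)
    (P : cprobability R T) : P set0 = 0.
Proof.
have cvgP : (fun N => \sum_(0 <= k < N) P set0 : R[i]^o) @ \oo -->
    (P set0 : R[i]^o).
  have set0E : set0 = \bigcup_(k in [set: nat]) set0 :> set T by rewrite bigcup0.
  rewrite [in X in _ --> X]set0E.
  by apply: cprob_sigma_additive => //; exact: trivIset_set0.
have cvgS : (fun N => \sum_(0 <= k < N.+1) P set0 : R[i]^o) @ \oo -->
    (P set0 : R[i]^o).
  by move: (cvgP); rewrite -cvg_shiftS.
rewrite -(subrr (P set0)); apply: complex_cvg_unique (cvgB cvgS cvgP).
rewrite [X in X @ _](_ : _ = cst (P set0 : R[i]^o)); first exact: cvg_cst.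
by apply/funext => N; rewrite !fctE /= big_nat_recr //= addrAC subrr add0r.
Qed.

(** The injection [pickle] of Z^g into the naturals cuts A into a disjoint sequence of measurable
    slices, to which countable additivity applies. *)
Lemma law_cvg_atoms {R : realType} {g : nat} {d : measure_display}
    {T : measurableType d} (P : cprobability R T) (X : lattice_rv g T)
    (A : set 'cV[int]_g) :
  (fun N => \sum_(0 <= k < N) law P X (A `&` [set v | pickle v = k]) : R[i]^o)
    @ \oo --> (law P X A : R[i]^o).
Proof.
have AE : A = \bigcup_k (A `&` [set v | pickle v = k]).
  rewrite -setI_bigcupr; apply: esym; apply: setIidl => v _.
  by exists (pickle v).
rewrite [in X in _ --> X]AE /law preimage_bigcup.
apply: cprob_sigma_additive.
  by move=> k; exact: rv_measurable.
by move=> i j _ _ [t [[_ <-] [_ <-]]].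
Qed.

Lemma law_proportional_atoms (R : realType) (g : nat)
    (d1 d2 : measure_display) (T1 : measurableType d1) (T2 : measurableType d2)
    (P1 : cprobability R T1) (X1 : lattice_rv g T1)
    (P2 : cprobability R T2) (X2 : lattice_rv g T2) (c : R[i]) :
  (forall k, law P1 X1 [set k] = c * law P2 X2 [set k]) ->
  forall A, law P1 X1 A = c * law P2 X2 A.
Proof.
move=> atoms A.
have slice k : law P1 X1 (A `&` [set v | pickle v = k]) =
    c * law P2 X2 (A `&` [set v | pickle v = k]).
  (* A slice is empty, if k codes no point of A, or a single point, by injectivity of [pickle]. *)
  have [->|/set0P[v [Av vk]]] := eqVneq (A `&` [set v | pickle v = k]) set0.
    by rewrite /law !preimage_set0 !cprob_set0 mulr0.
  suff -> : A `&` [set v | pickle v = k] = [set v] by exact: atoms.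
  apply/seteqP; split => [w [_ /= wk]|w ->//].
  by apply: (pcan_inj pickleK); rewrite wk.
apply: complex_cvg_unique (law_cvg_atoms P1 X1 A) _.
rewrite [X in X @ _](_ : _ = (fun N =>
    c *: \sum_(0 <= k < N) law P2 X2 (A `&` [set v | pickle v = k]) : R[i]^o)).
  exact: cvgZl_tmp (law_cvg_atoms P2 X2 A).
by apply/funext => N; rewrite scaler_sumr; apply: eq_bigr => k _; exact: slice.
Qed.

Theorem proposition3p1 (R : realType) (g : nat) (hg : (1 <= g)%N)
    (u : 'cV[R[i]]_g) (B : 'M[R[i]]_g)
    (huB : ((setT `*` @siegel R g) `\` @Theta R g) (u, B))
    (m n : 'cV[int]_g)
    (d1 d2 : measure_display) (T1 : measurableType d1) (T2 : measurableType d2)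
    (P1 : cprobability R T1) (X1 : lattice_rv g T1)
    (P2 : cprobability R T2) (X2 : lattice_rv g T2) :
  is_discrete_gaussian P1 X1
    (u + 'i%C *: zvec R m + B *m zvec R n) B ->
  is_discrete_gaussian P2 X2 u B ->
  same_law P1 X1 P2 (shift_rv X2 n).
Proof.
case: huB => -[_ siegB] notTheta gauss1 gauss2.
have theta_neq0 : theta u B != 0 by apply/eqP => theta0; exact: notTheta.
have symB : B^T = B by case: siegB.
set u' := u + _ + _ in gauss1.
set q := e2pi (2^-1 * ((zvec R n)^T *m B *m zvec R n) 0 0
               + ((zvec R n)^T *m u) 0 0).
(* It is not known here that [theta u' B] is nonzero. If it vanished, its inverse would be 0 by
   convention and c would be 0; the proportionality below holds in either case. *)
pose c := (theta u' B)^-1 * q * theta u B.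
have shift_atom k : law P2 (shift_rv X2 n) [set k] = p_theta (k - n) u B.
  rewrite -gauss2 /law; congr (P2 _); apply/seteqP.
  by split=> t /= => [<-|->]; rewrite ?addrK ?subrK.
have prop : forall A, law P1 X1 A = c * law P2 (shift_rv X2 n) A.
  apply: law_proportional_atoms => k.
  rewrite gauss1 shift_atom /p_theta theta_term_quasiperiodic // -/q /c.
  (* The factor [theta u B] in c cancels the normalisation of [p_theta] at (u, B), which uses
     [theta_neq0]. *)
  by rewrite -!mulrA mulVKf.
(* Comparing total masses fixes c, and so rules out the degenerate value 0. *)
have c1 : c = 1.
  by have := prop setT; rewrite /law !preimage_setT !cprob_setT mulr1.
by move=> A; rewrite prop c1 mul1r.
Qed.
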